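(* There exist infinitely many pairwise non-isomorphic finite simple graphs $G$ such that $G$ is Hamiltonian, $G$ can be embedded on the torus, $G$ contains no subgraph isomorphic to $K_5^-$, and $G$ has chromatic number exactly $5$.
   Context: $K_5^-$ denotes the complete graph $K_5$ with one edge removed. A graph is Hamiltonian if it contains a cycle through all its vertices. *)

(* Defs.v *)
From HB Require Import structures.
From mathcomp Require Import all_boot all_order all_algebra.
From mathcomp Require Import all_classical all_reals all_analysis.

Set Implicit Arguments.
Unset Strict Implicit.
Unset Printing Implicit Defensive.

Import Order.TTheory GRing.Theory Num.Theory numFieldNormedType.Exports.

Local Open Scope classical_set_scope.
Local Open Scope quotient_scope.
Local Open Scope ring_scope.

Record sgraph := SGraph {
  vertex :> finType;
  adj : rel vertex;
  adj_sym : symmetric adj;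
  adj_irrefl : irreflexive adj }.

Definition isomorphic (G H : sgraph) : Prop :=
  exists f : G -> H,
    bijective f /\ forall u v : G, adj (f u) (f v) = adj u v.

(* The copy of H is the image of f; it need not be an induced subgraph. *)
Definition has_subgraph (H G : sgraph) : Prop :=
  exists f : H -> G,
    injective f /\ forall u v : H, adj u v -> adj (f u) (f v).

(* The missing edge is {0, 1}. *)
Definition K5minus_adj : rel 'I_5 :=
  fun i j => (i != j) && ~~ ((i < 2)%N && (j < 2)%N).

Lemma K5minus_sym : symmetric K5minus_adj.
Proof. by move=> i j; rewrite /K5minus_adj eq_sym andbC [(_ < _)%N && _]andbC andbC. Qed.

Lemma K5minus_irrefl : irreflexive K5minus_adj.
Proof. by move=> i; rewrite /K5minus_adj eqxx. Qed.

Definition K5minus : sgraph := SGraph K5minus_sym K5minus_irrefl.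

(* The size condition excludes the degenerate ucycle u, v, u along one edge. *)
Definition hamiltonian (G : sgraph) : Prop :=
  exists c : seq G,
    [/\ (2 < size c)%N, ucycle (@adj G) c & forall v : G, v \in c].

Definition colorable (G : sgraph) (k : nat) : bool :=
  [exists f : {ffun G -> 'I_k},
     [forall u, forall v, adj u v ==> (f u != f v)]].

Lemma colorable_card (G : sgraph) : exists k, colorable G k.
Proof.
exists #|G|; apply/existsP; exists [ffun v => enum_rank v].
apply/forallP => u; apply/forallP => v; apply/implyP => uv.
rewrite !ffunE (inj_eq enum_rank_inj); apply: contraTneq uv => ->.
by rewrite adj_irrefl.
Qed.

Definition chromatic_number (G : sgraph) : nat := ex_minn (colorable_card G).

Definition eq_modZ (R : realType) : rel (R * R) :=
  fun p q => (p.1 - q.1 \is a Num.int) && (p.2 - q.2 \is a Num.int).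

Lemma eq_modZ_refl (R : realType) : reflexive (@eq_modZ R).
Proof. by move=> p; rewrite /eq_modZ !subrr !rpred0. Qed.

Lemma eq_modZ_sym (R : realType) : symmetric (@eq_modZ R).
Proof.
by move=> p q; rewrite /eq_modZ -(opprB q.1) -(opprB q.2) !rpredN.
Qed.

Lemma eq_modZ_trans (R : realType) : transitive (@eq_modZ R).
Proof.
move=> q p r /andP[pq1 pq2] /andP[qr1 qr2]; apply/andP; split.
  by rewrite -(subrKA q.1) rpredD.
by rewrite -(subrKA q.2) rpredD.
Qed.

Canonical eq_modZ_equiv (R : realType) : equiv_rel (R * R)%type :=
  EquivRel (@eq_modZ R)
    (@eq_modZ_refl R) (@eq_modZ_sym R) (@eq_modZ_trans R).

(* R^2 / Z^2 with the quotient topology. *)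
Definition torus (R : realType) : topologicalType :=
  quotient_topology {eq_quot (@eq_modZ R)}.

Definition edges (G : sgraph) : set {set G} :=
  [set A | exists u v : G, adj u v /\ A = [set u; v]%SET].

(* Each edge is drawn as a simple arc joining the images of its two ends; the
   interiors of the arcs contain no vertex and are pairwise disjoint. Since G
   is finite and the torus is Hausdorff, this is an embedding of the geometric
   realization of G. *)
Definition toroidal (R : realType) (G : sgraph) : Prop :=
  exists (pos : G -> torus R) (arc : {set G} -> R -> torus R),
    [/\ injective pos,
        forall A, edges A ->
          {within `[0, 1], continuous (arc A)} /\ set_inj `[0, 1] (arc A),
        forall u v : G, adj u v ->
          [set arc [set u; v]%SET 0; arc [set u; v]%SET 1] = [set pos u; pos v],
        forall A, edges A -> arc A @` `]0, 1[ `&` range pos = set0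
      & trivIset (@edges G) (fun A => arc A @` `]0, 1[)].

(* Main.v *)
(** The circulant graph C13(1, 3, 4), i.e. the Paley graph on 13 vertices, has
    neither a clique nor a stable set of size 4: it contains no K5^- and needs
    at least 13/3 > 4 colours. Mapping (x, y) to x + 3y mod 13 identifies it with
    the quotient of the triangular grid (Z^2 with edge directions (1, 0), (0, 1)
    and (1, 1)) by the lattice {(x, y) | 13 divides x + 3y}, hence with a
    triangulation of the torus. Adding a path 12, 13, ..., N-1, 0 next to the edge
    {12, 0} creates only vertices of degree 2, so K5^- is still absent, 5 colours
    still suffice, the path is drawn inside a triangle, and 0, 1, ..., N-1 is a
    Hamiltonian cycle. The graphs obtained for different N have different orders. *)
Require Import Defs.
From mathcomp Require Import all_boot all_order all_algebra.
From mathcomp Require Import all_classical all_reals all_analysis.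
From mathcomp Require Import zify ring lra.

Set Implicit Arguments.
Unset Strict Implicit.
Unset Printing Implicit Defensive.

Import Order.TTheory GRing.Theory Num.Theory numFieldNormedType.Exports.

(** * The graphs *)

(** Together with their negatives, 1, 3 and 4 are the nonzero squares modulo 13. Adding 13 keeps the
    truncated subtraction exact for [i] up to 13. *)
Definition paley_arc (i j : nat) : bool := ((j + 13 - i) %% 13 \in [:: 1; 3; 4])%N.

(* Each edge in the orientation along which it is drawn: the steps +1, +3, +4
   modulo 13, then the path 12, 13, ..., N - 1, 0. *)
Definition oedge (N i j : nat) : bool :=
  ((i < 13) && (j < 13) && paley_arc i j || (12 <= i) && (j == i.+1 %% N))%N.

Definition edge (N i j : nat) : bool := oedge N i j || oedge N j i.

(** * Cliques and stable sets of the Paley graph *)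

Definition paley_edge (i j : nat) : bool := paley_arc i j || paley_arc j i.

(** Exhaustive evaluation; a quadruple with a repeated entry passes too, as 0 is not a step of
    [paley_arc]. *)
Lemma paley_clique4_free (a b c d : nat) :
  (a < 13)%N -> (b < 13)%N -> (c < 13)%N -> (d < 13)%N ->
  ~~ [&& paley_edge a b, paley_edge a c, paley_edge a d, paley_edge b c,
         paley_edge b d & paley_edge c d].
Proof.
have: all (fun a => all (fun b => all (fun c => all (fun d =>
    ~~ [&& paley_edge a b, paley_edge a c, paley_edge a d, paley_edge b c,
           paley_edge b d & paley_edge c d])
  (iota 0 13)) (iota 0 13)) (iota 0 13)) (iota 0 13).
  by vm_compute.
move=> + a13 b13 c13 d13.
by move=> /allP/(_ a)/[!mem_iota]/(_ a13)/allP/(_ b)/[!mem_iota]/(_ b13)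
  /allP/(_ c)/[!mem_iota]/(_ c13)/allP/(_ d)/[!mem_iota]/(_ d13).
Qed.

Lemma paley_stable4_free (a b c d : nat) :
  (a < 13)%N -> (b < 13)%N -> (c < 13)%N -> (d < 13)%N -> uniq [:: a; b; c; d] ->
  [|| paley_edge a b, paley_edge a c, paley_edge a d, paley_edge b c,
      paley_edge b d | paley_edge c d].
Proof.
have: all (fun a => all (fun b => all (fun c => all (fun d =>
    uniq [:: a; b; c; d] ==>
    [|| paley_edge a b, paley_edge a c, paley_edge a d, paley_edge b c,
        paley_edge b d | paley_edge c d])
  (iota 0 13)) (iota 0 13)) (iota 0 13)) (iota 0 13).
  by vm_compute.
move=> + a13 b13 c13 d13.
by move=> /allP/(_ a)/[!mem_iota]/(_ a13)/allP/(_ b)/[!mem_iota]/(_ b13)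
  /allP/(_ c)/[!mem_iota]/(_ c13)/allP/(_ d)/[!mem_iota]/(_ d13)/implyP.
Qed.

Lemma oedge_irrefl N i : (13 < N)%N -> oedge N i i = false.
Proof.
move=> N14; rewrite /oedge /paley_arc addKn /= andbF /=.
apply/negbTE/negP => /andP[i12 /eqP].
have [iN|Ni|->] := ltngtP i.+1 N; [by rewrite modn_small; lia| |by rewrite modnn; lia].
have : (i.+1 %% N < N)%N by rewrite ltn_mod; lia.
lia.
Qed.

(** * The Paley graph with a path attached *)

Section Graph.
Variable n : nat.
(** The offset 14 puts at least one new vertex on the path, so no path edge joins two vertices below
    13. *)
Let N := (14 + n)%N.

Definition paley_path_adj : rel 'I_N := fun u v => edge N u v.

Lemma paley_path_sym : symmetric paley_path_adj.
Proof. by move=> u v; rewrite /paley_path_adj /edge orbC. Qed.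

Lemma paley_path_irrefl : irreflexive paley_path_adj.
Proof. by move=> u; rewrite /paley_path_adj /edge oedge_irrefl. Qed.

Definition paley_path : sgraph := SGraph paley_path_sym paley_path_irrefl.

Lemma edge_small i j : (i < 13)%N -> (j < 13)%N -> edge N i j = paley_edge i j.
Proof.
move=> i13 j13; rewrite /edge /oedge /paley_edge i13 j13 /=.
have wrap k : (k < 13)%N -> (k.+1 %% N = k.+1)%N.
  by move=> k13; rewrite modn_small /N//; lia.
rewrite !wrap//.
have s12 k l : (k < 13)%N -> (l < 13)%N -> (12 <= k)%N && (l == k.+1) = false.
  by move=> ? ?; apply/negbTE/negP => /andP[? /eqP]; lia.
by rewrite !s12// !orbF.
Qed.

Lemma edge_large i j : (i < N)%N -> (j < N)%N -> (12 < i)%N -> edge N i j ->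
  j = i.-1 \/ j = (i.+1 %% N)%N.
Proof.
move=> iN jN i12; rewrite /edge /oedge ltnNge i12 /= andbF /= => /orP[/andP[_ /eqP ->]|].
  by right.
move=> /andP[j12 /eqP]; have [jlt|] := ltnP j.+1 N.
  by rewrite modn_small// => ->; left.
move=> Nj; have -> : j.+1 = N by apply/eqP; rewrite eqn_leq jN.
by rewrite modnn => i0; rewrite i0 in i12.
Qed.

Lemma edge_irrefl i : edge N i i = false.
Proof. by rewrite /edge oedge_irrefl. Qed.

Lemma edge_sym i j : edge N i j = edge N j i.
Proof. exact: orbC. Qed.

(** Beyond 12 a vertex has at most two neighbours, so two of [b], [c], [d] would coincide and form a
    loop. *)
Lemma edge_clique_small a b c d :
  (a < N)%N -> (b < N)%N -> (c < N)%N -> (d < N)%N ->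
  edge N a b -> edge N a c -> edge N a d -> edge N b c -> edge N b d -> edge N c d ->
  (a < 13)%N.
Proof.
move=> aN bN cN dN ab ac ad bc bd cd; rewrite ltnNge; apply/negP => a12.
case: (edge_large aN bN a12 ab) (edge_large aN cN a12 ac) (edge_large aN dN a12 ad)
  => bE [] cE [] dE; by [rewrite bE cE edge_irrefl in bc | rewrite bE dE edge_irrefl in bd
    | rewrite cE dE edge_irrefl in cd].
Qed.

Lemma edge_clique4_free a b c d :
  (a < N)%N -> (b < N)%N -> (c < N)%N -> (d < N)%N ->
  ~ [&& edge N a b, edge N a c, edge N a d, edge N b c, edge N b d & edge N c d].
Proof.
move=> aN bN cN dN /and5P[ab ac ad bc /andP[bd cd]].
have [ba ca da] : [/\ edge N b a, edge N c a & edge N d a] by split; rewrite edge_sym.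
have [cb db dc] : [/\ edge N c b, edge N d b & edge N d c].
  by split; rewrite edge_sym.
have a13 := edge_clique_small aN bN cN dN ab ac ad bc bd cd.
have b13 := edge_clique_small bN aN cN dN ba bc bd ac ad cd.
have c13 := edge_clique_small cN aN bN dN ca cb cd ab ad bd.
have d13 := edge_clique_small dN aN bN cN da db dc ab ac bc.
have /negP := paley_clique4_free a13 b13 c13 d13.
by apply; rewrite -!edge_small// ab ac ad bc bd cd.
Qed.

Lemma paley_path_hamiltonian : hamiltonian paley_path.
Proof.
exists (enum 'I_N); split.
- by rewrite size_enum_ord.
- apply/andP; split; last exact: enum_uniq.
  have -> : cycle (@adj paley_path) (enum 'I_N) = cycle (edge N) (map val (enum 'I_N)).
    by rewrite cycle_map.
  rewrite val_enum_ord /= rcons_path.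
  have stepE i : (i.+1 < N)%N -> edge N i i.+1.
    move=> iN; rewrite /edge /oedge modn_small// eqxx andbT.
    (* From 12 on the path supplies the edge; before 12 the Paley step 1 does. *)
    have [|i12] := leqP 12 i; first by rewrite orbT.
    rewrite /paley_arc (ltn_trans i12)//= ltnS i12 /=.
    by have -> : (i.+1 + 13 - i = 1 + 13)%N by lia.
  have pathE m i : (i + m < N)%N -> path (edge N) i (iota i.+1 m).
    elim: m i => //= m IH i im; rewrite stepE ?IH//; lia.
  apply/andP; split; first exact: (pathE (13 + n)%N 0%N).
  have lastE m : last 0 (iota 1 m) = m.
    by rewrite (last_nth 0) size_iota -[_ :: _]/(iota 0 m.+1) nth_iota.
  by rewrite [last _ _](lastE (13 + n)%N) /edge /oedge /= modnn.
- by move=> v; rewrite mem_enum.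
Qed.

(** The vertices 1, 2, 3, 4 avoid the missing edge {0, 1}, so a copy would contain a 4-clique. *)
Lemma paley_path_K5minus_free : ~ has_subgraph K5minus paley_path.
Proof.
case=> f [f_inj f_adj].
pose x (k : nat) : 'I_5 := inord k.
have fE (i j : nat) : (0 < i < 5)%N -> (1 < j < 5)%N -> i != j ->
    edge N (f (x i)) (f (x j)).
  move=> i5 j5 ij; apply: f_adj; rewrite /K5minus /= /K5minus_adj.
  rewrite -(inj_eq val_inj) /= !inordK; lia.
have fE' (i j : nat) : (0 < i < 5)%N -> (0 < j < 5)%N -> i != j ->
    edge N (f (x i)) (f (x j)).
  move=> i5 j5 ij; have [j1|j1] := ltnP 1 j; first by apply: fE => //; lia.
  by rewrite /edge orbC; apply: fE; lia.
have fN m : (f (x m) < N)%N by exact: ltn_ord.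
apply: (@edge_clique4_free (f (x 1)) (f (x 2)) (f (x 3)) (f (x 4))); first exact: fN.
- exact: fN.
- exact: fN.
- exact: fN.
- by rewrite !fE'.
Qed.

Lemma paley_path_colorable5 : colorable paley_path 5.
Proof.
(* The classes below 13 are {0, 2, 7}, its shifts by 1 and by 4, its image under x -> 12 - x, and
   {9}. New vertices alternate between colours 1 and 2, away from colour 3 of vertex 12 and colour 0
   of vertex 0. *)
pose col (i : nat) :=
  if (i < 13)%N then nth 0 [:: 0; 1; 0; 1; 2; 3; 2; 0; 1; 4; 3; 2; 3] i
  else (odd i).+1.
have small_col i j : (i < 13)%N -> (j < 13)%N -> paley_arc i j -> col i != col j.
  have: all (fun i => all (fun j => paley_arc i j ==> (col i != col j))
    (iota 0 13)) (iota 0 13).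
    by vm_compute.
  move=> + i13 j13.
  by move=> /allP/(_ i)/[!mem_iota]/(_ i13)/allP/(_ j)/[!mem_iota]/(_ j13)/implyP.
have col5 i : (col i < 5)%N.
  have [i13|i13] := ltnP i 13; last by rewrite /col (ltnNge i 13) i13; case: odd.
  have: all (fun i => col i < 5)%N (iota 0 13) by vm_compute.
  by move=> /allP/(_ i)/[!mem_iota]/(_ i13).
have col_oedge i j : (i < N)%N -> (j < N)%N -> oedge N i j -> col i != col j.
  move=> iN jN /orP[/andP[/andP[]]|/andP[i12 /eqP]]; first exact: small_col.
  have [iN'|] := ltnP i.+1 N; last first.
    move=> Ni; have -> : i = (13 + n)%N by lia.
    by rewrite modnn => ->; rewrite /col /=; case: odd.
  rewrite modn_small// => ->; have [->//|i13] := eqVneq i 12%N.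
  have i13' : (12 < i)%N by rewrite ltn_neqAle eq_sym i13.
  by rewrite /col (ltnNge i 13) (ltnNge i.+1 13) i13' (leqW i13') /=; case: odd.
apply/existsP; exists [ffun v : paley_path => Ordinal (col5 (v : 'I_N))].
apply/forallP => u; apply/forallP => v; apply/implyP.
rewrite !ffunE -(inj_eq val_inj) /= => /orP[/col_oedge|/col_oedge]; first exact.
by rewrite eq_sym; apply.
Qed.

Lemma paley_path_not_colorable4 : ~~ colorable paley_path 4.
Proof.
apply/negP => /existsP[f /forallP fP].
have {}fP u v : adj u v -> f u != f v by move: (fP u) => /forallP/(_ v)/implyP.
have w13 : (13 <= N)%N by [].
pose g (i : 'I_13) : 'I_4 := f (widen_ord w13 i).
have gP (i j : 'I_13) : paley_edge i j -> g i != g j.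
  by move=> ij; apply: fP; rewrite /= /paley_path_adj /= edge_small.
(* Pigeonhole: four classes of at most 3 vertices would cover at most 12 of the 13. *)
have [c cP] : exists c, (3 < #|[set i | g i == c]|)%N.
  apply/existsP; apply: contraT => /existsPn le3.
  have : (\sum_(c < 4) #|[set i | g i == c]| <= \sum_(c < 4) 3)%N.
    by apply: leq_sum => c _; rewrite leqNgt le3.
  rewrite sum_nat_const card_ord.
  have -> : (\sum_(c < 4) #|[set i | g i == c]|)%N = 13%N.
    rewrite -[RHS]card_ord -sum1_card (partition_big g predT)//=.
    by apply: eq_bigr => c _; rewrite -sum1_card; apply: eq_bigl => i; rewrite inE.
  by [].
move: cP; rewrite cardE; have := enum_uniq [set i | g i == c].
have : {in enum [set i | g i == c], forall i, g i = c}.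
  by move=> i; rewrite mem_enum inE => /eqP.
case: (enum _) => [|i1 [|i2 [|i3 [|i4 s]]]]// gc.
rewrite (cat_uniq [:: i1; i2; i3; i4] s) => /andP[u _] _.
have gc4 : {in [:: i1; i2; i3; i4], forall i, g i = c}.
  by move=> i ii; apply: gc; have := mem_cat i [:: i1; i2; i3; i4] s; rewrite ii.
have nadj (i j : 'I_13) :
    i \in [:: i1; i2; i3; i4] -> j \in [:: i1; i2; i3; i4] -> ~~ paley_edge i j.
  by move=> /gc4 gi /gc4 gj; apply/negP => /gP; rewrite gi gj eqxx.
have := @paley_stable4_free i1 i2 i3 i4.
rewrite !ltn_ord => /(_ isT isT isT isT).
rewrite -(map_inj_uniq val_inj) in u; move=> /(_ u).
by do ?[rewrite (negbTE (nadj _ _ _ _)) ?inE ?eqxx ?orbT//=].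
Qed.

Lemma paley_path_chromatic : chromatic_number paley_path = 5%N.
Proof.
rewrite /chromatic_number; case: ex_minnP => k kP kmin.
have := kmin _ paley_path_colorable5; rewrite leq_eqVlt => /orP[/eqP//|k4].
(* With [k] below 5, a [k]-colouring is also a 4-colouring. *)
case/negP: paley_path_not_colorable4.
move: kP => /existsP[f /forallP fP].
apply/existsP; exists [ffun v => widen_ord (k4 : k <= 4)%N (f v)].
apply/forallP => u; apply/forallP => v; apply/implyP => uv; rewrite !ffunE.
rewrite -(inj_eq val_inj) /= (inj_eq val_inj).
by move: (fP u) => /forallP/(_ v)/implyP; apply.
Qed.
End Graph.

Lemma isomorphic_card (G H : sgraph) : isomorphic G H -> #|G| = #|H|.
Proof. by case=> f [/bij_eq_card]. Qed.

(** * Drawing on the torus *)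

Local Open Scope classical_set_scope.
Local Open Scope quotient_scope.
Local Open Scope ring_scope.

(** * Lifting drawings from the torus to the plane *)

Section Torus.
Variable R : realType.
Implicit Types (P Q : R * R) (s t : R).

Definition torus_pi (P : R * R) : torus R := \pi_{eq_quot (@eq_modZ R)} P.

Lemma torus_piP P Q : reflect (torus_pi P = torus_pi Q) (eq_modZ P Q).
Proof. exact: eqmodP. Qed.

Lemma torus_pi_continuous : continuous torus_pi.
Proof. exact: pi_continuous. Qed.

(** Reduces a drawing to plane curves, one per oriented edge of [D], compared only modulo Z^2. The
    last hypothesis gives both the disjointness of different arcs and the injectivity of each on its
    interior. *)
Lemma toroidal_of_lift (G : sgraph) (D : rel G) (p : G -> R * R)
    (g : G -> G -> R -> R * R) :
  (forall u v, adj u v = D u v || D v u) ->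
  (forall u v, eq_modZ (p u) (p v) -> u = v) ->
  (forall u v, D u v -> [/\ continuous (g u v), eq_modZ (g u v 0) (p u)
                          & eq_modZ (g u v 1) (p v)]) ->
  (forall u v w t, D u v -> 0 < t < 1 -> ~~ eq_modZ (g u v t) (p w)) ->
  (forall u v u' v' t t', D u v -> D u' v' -> 0 < t < 1 -> 0 < t' < 1 ->
     eq_modZ (g u v t) (g u' v' t') -> [/\ u = u', v = v' & t = t']) ->
  toroidal R G.
Proof.
move=> adjE p_inj g_ends g_vert g_int.
pose e (A : {set G}) :=
  [pick uv : G * G | D uv.1 uv.2 && (A == [set uv.1; uv.2]%SET)].
pose arc (A : {set G}) : R -> torus R :=
  if e A is Some uv then torus_pi \o g uv.1 uv.2 else fun=> torus_pi 0.
have arcP A : edges A -> exists u v,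
    [/\ D u v, A = [set u; v]%SET & arc A = torus_pi \o g u v].
  case=> u [v [uv ->]]; rewrite /arc /e; case: pickP => [[u' v'] /= |/=].
    by move=> /andP[Duv /eqP ->]; exists u', v'.
  move: uv; rewrite adjE => /orP[uv /(_ (u, v))|vu /(_ (v, u))] /=.
    by rewrite uv eqxx.
  by rewrite vu finset.setUC eqxx.
exists (torus_pi \o p), arc; split.
- by move=> u v /torus_piP/p_inj.
- move=> A /arcP[u [v [Duv _ ->]]]; have [gc g0 g1] := g_ends _ _ Duv.
  split.
    apply: continuous_subspaceT => x; apply: continuous_comp; first exact: gc.
    exact: torus_pi_continuous.
  have Npuv : ~~ eq_modZ (p u) (p v).
    apply/negP => /p_inj uv; have := adjE u v.
    by rewrite Duv uv adj_irrefl.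
  (* Injectivity extends to the ends: an interior point congruent to an end would be congruent to a
     vertex, and the two ends lie over distinct vertices. *)
  have cases (x : R) : x \in `[0, 1]%classic -> [\/ x = 0, x = 1 | 0 < x < 1].
    rewrite inE /= in_itv /= => /andP[x0 x1].
    have [->|x0'] := eqVneq x 0; first by constructor 1.
    have [->|x1'] := eqVneq x 1; first by constructor 2.
    by constructor 3; rewrite !lt_neqAle eq_sym x0' x0 x1' x1.
  have end0 (x : R) : 0 < x < 1 -> ~ eq_modZ (g u v x) (g u v 0).
    move=> /(g_vert u v u x Duv) /negP + xy; apply.
    exact: eq_modZ_trans xy g0.
  have end1 (x : R) : 0 < x < 1 -> ~ eq_modZ (g u v x) (g u v 1).
    move=> /(g_vert u v v x Duv) /negP + xy; apply.
    exact: eq_modZ_trans xy g1.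
  have end01 : ~ eq_modZ (g u v 0) (g u v 1).
    move=> xy; move/negP: Npuv; apply.
    apply: eq_modZ_trans (eq_modZ_trans xy g1).
    by rewrite eq_modZ_sym.
  have eC x y : eq_modZ (g u v x) (g u v y) -> eq_modZ (g u v y) (g u v x).
    by rewrite eq_modZ_sym.
  move=> x y /cases xc /cases yc /torus_piP xy; have yx := eC _ _ xy.
  case: xc xy yx => [->|->|x01]; case: yc => [->|->|y01] xy yx //.
  + by case: (end0 _ y01 yx).
  + by case: (end1 _ y01 yx).
  + by case: (end0 _ x01 xy).
  + by case: (end1 _ x01 xy).
  + by have [] := g_int _ _ _ _ _ _ Duv Duv x01 y01 xy.
- move=> u v uv; have Auv : edges [set u; v]%SET by exists u, v.
  have [u' [v' [Duv AE ->]]] := arcP _ Auv; have [_ g0 g1] := g_ends _ _ Duv.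
  rewrite /= (torus_piP _ _ g0) (torus_piP _ _ g1).
  (* The picked orientation may be the reverse of [(u, v)]; only the unordered pair of ends
     matters. *)
  have := set22 u' v'; have := set21 u' v'; rewrite -AE !finset.inE.
  have := set22 u v; have := set21 u v; rewrite AE !finset.inE.
  case/orP=> /eqP -> /orP[] /eqP -> //.
  + by move=> _; rewrite orbb => /eqP ->.
  + by rewrite classical_sets.setUC.
  + by rewrite orbb => /eqP ->.
- move=> A /arcP[u [v [Duv _ ->]]]; apply/seteqP; split=> // x [[t /=]].
  rewrite in_itv /= => t01 <- [w _] /esym/torus_piP.
  by apply/negP; exact: g_vert.
- move=> A B /arcP[u [v [Duv -> ->]]] /arcP[u' [v' [Duv' -> ->]]].
  case=> x [[t /=]]; rewrite in_itv /= => t01 <- [t' /=].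
  rewrite in_itv /= => t01' /esym/torus_piP.
  by case/(g_int _ _ _ _ _ _ Duv Duv' t01 t01') => -> ->.
Qed.
End Torus.

(** * Integrality and the triangular grid *)

Section Drawing.
Variable R : realType.
Implicit Types (P Q : R * R) (s t : R).

Lemma int_norm_lt1 t : t \is a Num.int -> `|t| < 1 -> t = 0.
Proof.
move=> tZ t1; apply/eqP; apply: contraTT t1 => t0.
by rewrite -leNgt norm_intr_ge1.
Qed.

Lemma unit_itv_not_int t : 0 < t < 1 -> (t \is a Num.int) = false.
Proof.
move=> t01; apply/negbTE/negP => /int_norm_lt1 t0.
have : t = 0 by apply: t0; rewrite ltr_norml; lra.
lra.
Qed.

Lemma unit_itv_inj s t : 0 < s < 1 -> 0 < t < 1 -> s - t \is a Num.int -> s = t.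
Proof.
move=> s01 t01 /int_norm_lt1 st0; apply/eqP; rewrite -subr_eq0 st0//.
by rewrite ltr_norml; lra.
Qed.

(* The linear map with matrix [[1, 3], [4, -1]] / 13 identifies the quotient of
   the plane by {(x, y) in Z^2 | 13 divides x + 3 y} with the torus. *)
Definition chart P : R * R := ((P.1 + 3 * P.2) / 13, (4 * P.1 - P.2) / 13).

Lemma eq_modZ_chart P Q :
  eq_modZ (chart P) (chart Q) =
  (((P.1 - Q.1) + 3 * (P.2 - Q.2)) / 13 \is a Num.int) &&
  ((4 * (P.1 - Q.1) - (P.2 - Q.2)) / 13 \is a Num.int).
Proof. by rewrite /eq_modZ /=; congr andb; congr (_ \is a _); field. Qed.

(** The integer matrix [[1, 3], [4, -1]] has square 13 times the identity, hence inverts [chart]. *)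
Lemma chart_int P Q : eq_modZ (chart P) (chart Q) ->
  (P.1 - Q.1 \is a Num.int) /\ (P.2 - Q.2 \is a Num.int).
Proof.
rewrite eq_modZ_chart => /andP[]; set p := _ / 13; set q := _ / 13 => pZ qZ.
have -> : P.1 - Q.1 = p + 3 * q by rewrite /p /q; field.
have -> : P.2 - Q.2 = 4 * p - q by rewrite /p /q; field.
split; first exact: rpredD pZ (rpredM (natr_int _ _) qZ).
exact: rpredB (rpredM (natr_int _ _) pZ) qZ.
Qed.

(* Horizontal, vertical and diagonal edges of the triangular grid, its vertices,
   and the interiors of its triangles have five different types. *)
Definition grid_type P :=
  (P.1 \is a Num.int, P.2 \is a Num.int, P.1 - P.2 \is a Num.int).

(** Lets curves of different types be separated on the torus by comparing types alone. *)
Lemma chart_grid_type P Q :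
  eq_modZ (chart P) (chart Q) -> grid_type P = grid_type Q.
Proof.
move=> /chart_int[X Y]; rewrite /grid_type -(subrK Q.1 P.1) -(subrK Q.2 P.2).
rewrite !(rpredDl _ X) !(rpredDl _ Y); congr (_, _, _).
have -> : P.1 - Q.1 + Q.1 - (P.2 - Q.2 + Q.2) =
          (P.1 - Q.1 - (P.2 - Q.2)) + (Q.1 - Q.2) by ring.
by rewrite rpredDl// rpredB.
Qed.

(** The first coordinates [i / 13] and [j / 13] differ by an integer strictly between -1 and 1. *)
Lemma chart_nat_inj (i j : nat) : (i < 13)%N -> (j < 13)%N ->
  eq_modZ (chart (i%:R, 0)) (chart (j%:R, 0)) -> i = j.
Proof.
move=> i13 j13; rewrite eq_modZ_chart /= => /andP[+ _] => /int_norm_lt1 ij.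
apply/eqP; rewrite -(eqr_nat R); apply/eqP.
have i13' : i%:R < 13 :> R by rewrite ltr_nat.
have j13' : j%:R < 13 :> R by rewrite ltr_nat.
have i0 : 0 <= i%:R :> R by rewrite ler0n.
have j0 : 0 <= j%:R :> R by rewrite ler0n.
suff : (i%:R - j%:R + 3 * (0 - 0)) / 13 = 0 :> R by lra.
by apply: ij; rewrite ltr_norml; lra.
Qed.

(** Under x + 3y the directions (1, 0), (0, 1) and (1, 1) become the steps 1, 3 and 4. *)
Definition segment (i k : nat) t : R * R :=
  (i%:R + (k != 3)%:R * t, (k != 1)%:R * t).

Lemma grid_type_vertex (i : nat) : grid_type (i%:R, 0) = (true, true, true).
Proof. by rewrite /grid_type /= subr0 natr_int int_num0. Qed.

Lemma grid_type_segment (i k : nat) t : k \in [:: 1; 3; 4]%N -> 0 < t < 1 ->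
  grid_type (segment i k t) = (k == 3, k == 1, k == 4)%N.
Proof.
move=> + /unit_itv_not_int tZ; rewrite !inE => /or3P[]/eqP ->; rewrite /grid_type /=;
  rewrite ?mul1r ?mul0r ?addr0 ?subr0 ?addrK -?addrA ?subrr ?addr0
    ?rpredDl ?rpredBl ?rpredN ?natr_int ?tZ ?int_num0//.
Qed.

(** Some coordinate advances by the parameter itself, so [s] and [t] agree modulo 1; subtracting the
    common displacement leaves the starting points. *)
Lemma segment_inj (i j k : nat) s t : (i < 13)%N -> (j < 13)%N ->
  k \in [:: 1; 3; 4]%N -> 0 < s < 1 -> 0 < t < 1 ->
  eq_modZ (chart (segment i k s)) (chart (segment j k t)) -> i = j /\ s = t.
Proof.
move=> i13 j13 k134 s01 t01 st.
have {}s_t : s = t.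
  have [] := chart_int st; rewrite /= => X Y; apply: unit_itv_inj => //.
  move: k134 X Y; rewrite !inE => /or3P[]/eqP -> /=; rewrite ?mul1r ?mul0r => X Y //.
  have -> : s - t = (i%:R + s - (j%:R + t)) - i%:R + j%:R by ring.
  by rewrite rpredDr ?natr_int// rpredBr ?natr_int.
split=> //; apply: chart_nat_inj => //; move: st; rewrite s_t !eq_modZ_chart /=.
by rewrite !subrr (_ : i%:R + _ - _ = i%:R - j%:R) //; ring.
Qed.

(* A parabolic arc in the triangle (12, 0), (13, 0), (13, 1), next to the edge
   from vertex 12 to vertex 0, which is the grid point (13, 0). *)
Definition bow s : R * R := (12 + s, s * (1 - s)).

(** Modulo integers the three numbers tested are s, s(1 - s) and s^2, all strictly between 0 and
    1. *)
Lemma grid_type_bow s : 0 < s < 1 -> grid_type (bow s) = (false, false, false).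
Proof.
move=> s01; rewrite /grid_type /= rpredDl ?natr_int// -(addrA 12) rpredDl ?natr_int//.
case/andP: s01 => s0 s1; have ss : 0 < s * s by rewrite mulr_gt0.
have ss' : 0 < s * (1 - s) by rewrite mulr_gt0 ?subr_gt0.
by congr (_, _, _); apply: unit_itv_not_int; apply/andP; split => //; lra.
Qed.

Lemma bow_inj s t : 0 < s < 1 -> 0 < t < 1 ->
  eq_modZ (chart (bow s)) (chart (bow t)) -> s = t.
Proof.
move=> s01 t01 /chart_int[/= + _].
by rewrite opprD addrACA subrr add0r => /unit_itv_inj; apply.
Qed.

(** * Vertices and curves of the drawing *)

Variable n : nat.
Let N := (14 + n)%N.

(** Affine from [12, N] onto [0, 1]; the value N stands for vertex 0 at the end of the path. *)
Definition bow_param (x : R) : R := (x - 12) / (N%:R - 12).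

Lemma N12_gt0 : 0 < N%:R - 12 :> R.
Proof. by rewrite subr_gt0 ltr_nat. Qed.

Lemma bow_param_itv x : 12 < x < N%:R -> 0 < bow_param x < 1.
Proof.
move=> /andP[x12 xN]; rewrite divr_gt0 ?N12_gt0 ?subr_gt0//=.
by rewrite ltr_pdivrMr ?N12_gt0// mul1r ltrD2r.
Qed.

Lemma bow_param_inj : injective bow_param.
Proof. by move=> x y /divIf xy; apply/(addIr (- 12))/xy; rewrite gt_eqF ?N12_gt0. Qed.

Definition vertex_point (i : nat) : R * R :=
  if (i < 13)%N then (i%:R, 0) else bow (bow_param i%:R).

Definition oedge_curve (i j : nat) t : R * R :=
  if (i < 13)%N && (j < 13)%N then segment i ((j + 13 - i) %% 13) t
  else bow (bow_param (i%:R + t)).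

Variant oedge_spec (i j : nat) : (R -> R * R) -> Prop :=
| PaleyArc of (i < 13)%N & (j < 13)%N & ((j + 13 - i) %% 13)%N \in [:: 1; 3; 4]%N :
    oedge_spec i j (segment i ((j + 13 - i) %% 13)%N)
| PathArc of (12 <= i)%N & (j = i.+1 %% N)%N :
    oedge_spec i j (fun t => bow (bow_param (i%:R + t))).

Lemma oedgeP i j : oedge N i j -> oedge_spec i j (oedge_curve i j).
Proof.
rewrite /oedge /oedge_curve => /orP[/andP[/andP[i13 j13] ij]|/andP[i12 /eqP jE]].
  rewrite (_ : (fun t => _) = segment i ((j + 13 - i) %% 13)%N).
    by constructor.
  by rewrite i13 j13.
(* Only [i = 12] could clash, and its successor on the path is 13. *)
suff -> : (i < 13)%N && (j < 13)%N = false by constructor.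
apply/negbTE/negP => /andP[i13]; have {i12 i13} i12 : i = 12%N by lia.
by rewrite jE i12.
Qed.

(** Vertex 12 is the start of the bow, so path edges can treat it like the new vertices. *)
Lemma vertex_point_path i : (12 <= i)%N -> vertex_point i = bow (bow_param i%:R).
Proof.
rewrite /vertex_point; case: (ltnP i 13) => // i13 i12; have -> : i = 12%N by lia.
by rewrite /bow_param subrr mul0r /bow addr0 mul0r.
Qed.

Lemma path_param_itv i t : (12 <= i)%N -> (i < N)%N -> 0 < t < 1 ->
  0 < bow_param (i%:R + t) < 1.
Proof.
move=> i12 iN t01; apply: bow_param_itv.
have : 12 <= i%:R :> R by rewrite ler_nat.
have : i%:R + 1 <= N%:R :> R by rewrite natr1 ler_nat.
lra.
Qed.

Lemma vertex_param_itv i : (12 < i)%N -> (i < N)%N -> 0 < bow_param i%:R < 1.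
Proof. by move=> i12 iN; apply: bow_param_itv; rewrite !ltr_nat i12. Qed.

Lemma grid_type_vertex_point i : (i < N)%N ->
  grid_type (vertex_point i) = let b := (i < 13)%N in (b, b, b).
Proof.
move=> iN; rewrite /vertex_point; case: (ltnP i 13) => i13; first exact: grid_type_vertex.
by rewrite grid_type_bow// vertex_param_itv.
Qed.

Lemma vertex_point_inj i j : (i < N)%N -> (j < N)%N ->
  eq_modZ (chart (vertex_point i)) (chart (vertex_point j)) -> i = j.
Proof.
move=> iN jN ij; have := chart_grid_type ij.
rewrite !grid_type_vertex_point//; move: ij; rewrite /vertex_point.
case: (ltnP i 13) => i13; case: (ltnP j 13) => j13 // ij _; first exact: chart_nat_inj ij.
apply/eqP; rewrite -(eqr_nat R); apply/eqP/bow_param_inj.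
by apply: bow_inj ij; exact: vertex_param_itv.
Qed.

Lemma natD_itv_inj i j s t : 0 < s < 1 -> 0 < t < 1 -> i%:R + s = j%:R + t ->
  i = j /\ s = t.
Proof.
move=> s01 t01 ij; have st : s = t.
  apply: unit_itv_inj => //.
  have -> : s - t = j%:R - i%:R by lra.
  by rewrite rpredB ?natr_int.
by split=> //; apply/eqP; rewrite -(eqr_nat R); apply/eqP; lra.
Qed.

(** An open segment has exactly one integral entry in its type, a vertex all or none. On the bow, an
    interior point of a path edge has a non-integral parameter before rescaling. *)
Lemma oedge_curve_vertex i j k t : oedge N i j -> (i < N)%N -> (k < N)%N -> 0 < t < 1 ->
  ~~ eq_modZ (chart (oedge_curve i j t)) (chart (vertex_point k)).
Proof.
move=> /oedgeP[i13 j13 ij|i12 _] iN kN t01; apply/negP => tk; have := chart_grid_type tk.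
  rewrite grid_type_segment// grid_type_vertex_point//=.
  by move: ij; rewrite !inE => /or3P[]/eqP ->; case: (ltnP k 13).
rewrite grid_type_bow ?path_param_itv// grid_type_vertex_point//=.
case: (ltnP k 13) => // k13 _; move: tk; rewrite vertex_point_path; last exact: ltnW.
move=> /bow_inj/bow_param_inj tk.
have : t \is a Num.int.
  have -> : t = k%:R - i%:R.
    by rewrite -tk ?path_param_itv ?vertex_param_itv//; ring.
  by rewrite rpredB ?natr_int.
by rewrite unit_itv_not_int.
Qed.

Lemma paley_arc_target i j : (i < 13)%N -> (j < 13)%N ->
  j = ((i + (j + 13 - i) %% 13) %% 13)%N.
Proof.
move=> i13 j13; rewrite modnDmr.
by rewrite subnKC ?modnDr ?modn_small//; lia.
Qed.

(** The type separates segments from the bow and reveals the direction of a segment; on the bow,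
    [i + s] determines [i] and [s]. *)
Lemma oedge_curve_inj i j i' j' s t :
  oedge N i j -> oedge N i' j' -> (i < N)%N -> (i' < N)%N -> 0 < s < 1 -> 0 < t < 1 ->
  eq_modZ (chart (oedge_curve i j s)) (chart (oedge_curve i' j' t)) ->
  [/\ i = i', j = j' & s = t].
Proof.
move=> /oedgeP[i13 j13 ij|i12 ->] /oedgeP[i13' j13' ij'|i12' ->] iN iN' s01 t01 st;
  have := chart_grid_type st; rewrite ?grid_type_bow ?path_param_itv ?grid_type_segment//.
- move=> tE; have kE : ((j + 13 - i) %% 13 = (j' + 13 - i') %% 13)%N.
    by move: tE; move: ij ij'; rewrite !inE => /or3P[]/eqP -> /or3P[]/eqP ->.
  move: st; rewrite kE => /segment_inj[]// iE sE; split=> //.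
  by rewrite (paley_arc_target i13 j13) kE iE -paley_arc_target.
- by move: ij; rewrite !inE => /or3P[]/eqP ->.
- by move: ij'; rewrite !inE => /or3P[]/eqP ->.
- move=> _; move: st => /bow_inj/bow_param_inj.
  by rewrite !path_param_itv// => /(_ isT isT)/natD_itv_inj[]// -> ->.
Qed.

Lemma oedge_curve_start i j : oedge N i j -> oedge_curve i j 0 = vertex_point i.
Proof.
case/oedgeP=> [i13 _ _|i12 _]; last by rewrite addr0 vertex_point_path.
by rewrite /segment !mulr0 addr0 /vertex_point i13.
Qed.

Lemma oedge_curve_end i j : oedge N i j -> (i < N)%N ->
  eq_modZ (chart (oedge_curve i j 1)) (chart (vertex_point j)).
Proof.
case/oedgeP=> [i13 j13 ij iN|i12 -> iN].
  (* [z] counts the wraps past 13. In the chart, the end of the segment exceeds the vertex by (z,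
     4z) for step 1 and by (z, 4z - 1) for steps 3 and 4. *)
  have [z zE] : exists z : int, ((i + (j + 13 - i) %% 13)%N%:R : R) - j%:R = 13 * z%:~R.
    have jE := paley_arc_target i13 j13.
    exists (Posz ((i + (j + 13 - i) %% 13) %/ 13)%N).
    by rewrite {1}(divn_eq (i + (j + 13 - i) %% 13) 13) -jE natrD natrM addrK mulrC.
  have z_int : z%:~R \is a @Num.int R by exact: intr_int.
  have z4_int : z%:~R * 4 \is a @Num.int R by exact: rpredM z_int (natr_int _ _).
  move: ij zE; rewrite natrD /vertex_point j13 eq_modZ_chart /= !mulr1 subr0.
  rewrite !inE => /or3P[]/eqP -> /= zE.
  + rewrite [X in X \is a _](_ : _ = z%:~R); last by lra.
    rewrite [X in _ && (X \is a _)](_ : _ = z%:~R * 4); last by lra.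
    by rewrite z_int z4_int.
  + rewrite [X in X \is a _](_ : _ = z%:~R); last by lra.
    rewrite [X in _ && (X \is a _)](_ : _ = z%:~R * 4 - 1); last by lra.
    by rewrite z_int rpredBr ?z4_int ?int_num1.
  + rewrite [X in X \is a _](_ : _ = z%:~R); last by lra.
    rewrite [X in _ && (X \is a _)](_ : _ = z%:~R * 4 - 1); last by lra.
    by rewrite z_int rpredBr ?z4_int ?int_num1.
have [iN1|iN1] := ltnP i.+1 N.
  by rewrite modn_small// natr1 vertex_point_path ?eq_modZ_refl// leqW.
(* The last path edge ends at (13, 0), whose chart exceeds that of vertex 0 by (1, 4). *)
have {iN1} iN1 : i.+1 = N by lia.
rewrite iN1 modnn natr1 iN1 /bow_param divff ?gt_eqF ?N12_gt0//.
rewrite eq_modZ_chart /=.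
have -> : (12 + 1 - 0 + 3 * (1 * (1 - 1) - 0)) / 13 = 1 :> R by field.
have -> : (4 * (12 + 1 - 0) - (1 * (1 - 1) - 0)) / 13 = 4 :> R by field.
by rewrite natr_int int_num1.
Qed.

(** * Continuity of the curves and assembly of the drawing *)

Lemma continuous_pair (T : topologicalType) (f g : T -> R) :
  continuous f -> continuous g -> continuous (fun x => (f x, g x)).
Proof. by move=> fc gc x; apply: (cvg_pair (fc x) (gc x)). Qed.

Lemma chart_continuous : continuous chart.
Proof.
apply: continuous_pair => P; apply: cvgMl; [apply: cvgD|apply: cvgB];
  by do ?[exact: cvg_fst|exact: cvg_snd|apply: cvgMr].
Qed.

Lemma oedge_curve_continuous i j : oedge N i j -> continuous (oedge_curve i j).
Proof.
case/oedgeP=> _ _ => [_|].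
  by apply: continuous_pair => x; [apply: cvgD; first exact: cvg_cst|];
    apply: cvgMr; exact: cvg_id.
have pc : continuous (fun t => bow_param (i%:R + t)).
  move=> x; apply: cvgMl; apply: cvgB; last exact: cvg_cst.
  by apply: cvgD; [exact: cvg_cst|exact: cvg_id].
apply: continuous_pair => x; first by apply: cvgD; [exact: cvg_cst|exact: pc].
by apply: cvgM; [exact: pc|apply: cvgB; [exact: cvg_cst|exact: pc]].
Qed.

Lemma paley_path_toroidal : toroidal R (paley_path n).
Proof.
apply: (@toroidal_of_lift _ (paley_path n) (fun u v => oedge N u v)
  (fun u => chart (vertex_point (u : 'I_N)))
  (fun u v t => chart (oedge_curve (u : 'I_N) (v : 'I_N) t))) => //.
- by move=> u v uv; apply/val_inj; exact: vertex_point_inj uv.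
- move=> u v uv; split.
  + move=> x; apply: continuous_comp; first exact: oedge_curve_continuous.
    exact: chart_continuous.
  + by rewrite oedge_curve_start// eq_modZ_refl.
  + exact: oedge_curve_end.
- by move=> u v w t uv t01; exact: oedge_curve_vertex.
- move=> u v u' v' s t uv uv' s01 t01 st.
  by have [/val_inj-> /val_inj-> ->] :=
    oedge_curve_inj uv uv' (ltn_ord _) (ltn_ord _) s01 t01 st.
Qed.
End Drawing.

Theorem theorem4 (R : realType) :
  exists G : nat -> sgraph,
    (forall n : nat,
       [/\ hamiltonian (G n),
           toroidal R (G n),
           ~ has_subgraph K5minus (G n)
         & chromatic_number (G n) = 5%N]) /\
    (forall m n : nat, m <> n -> ~ isomorphic (G m) (G n)).
Proof.
exists paley_path; split=> [n|m n mn /isomorphic_card].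
  split.
  - exact: paley_path_hamiltonian.
  - exact: paley_path_toroidal.
  - exact: paley_path_K5minus_free.
  - exact: paley_path_chromatic.
by rewrite !card_ord => /addnI.
Qed.
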